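(* For every integer $n\ge 0$, $$U_n=\det\left(\binom{i+j}{2i-j}\right)_{0\le i,j\le n-1}\qquad\text{and}\qquad V_n=\det\left(\binom{i+j+1}{2i-j}\right)_{0\le i,j\le n-1}.$$
   Context: Let $a_k=\frac{1}{2k+1}\binom{3k}{k}$ for integers $k\ge 0$ (the number of ternary trees with $k$ vertices). Define $$U_n=\det(a_{i+j})_{0\le i,j\le n-1},\qquad V_n=\det(a_{i+j+1})_{0\le i,j\le n-1}.$$ Determinants of $0\times 0$ matrices are $1$. A binomial coefficient $\binom{p}{q}$ is interpreted as $0$ if $p$ or $q$ is negative. *)

(* Defs.v *)
From mathcomp Require Import all_boot all_order all_algebra.

Set Implicit Arguments.
Unset Strict Implicit.
Unset Printing Implicit Defensive.

Import GRing.Theory.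
Local Open Scope ring_scope.

(* The division is a genuine one, hence the codomain rat. *)
Definition a (k : nat) : rat := 1 / (2 * k + 1)%:R * 'C(3 * k, k)%:R.

(* Binomial coefficient with integer arguments, 0 if either one is negative.
   With truncated subtraction on nat, 'C(i + j, 2 * i - j) would be 1 instead
   of 0 whenever 2 * i < j. *)
Definition binz (p q : int) : nat :=
  match p, q with
  | Posz m, Posz k => 'C(m, k)
  | _, _ => 0%N
  end.

Definition U (n : nat) : rat := \det (\matrix_(i < n, j < n) a (i + j)).

Definition V (n : nat) : rat := \det (\matrix_(i < n, j < n) a (i + j + 1)).

(* Main.v *)
Require Import Defs.
From mathcomp Require Import all_boot all_order all_algebra.
From mathcomp Require Import ring zify.

Set Implicit Arguments.
Unset Strict Implicit.
Unset Printing Implicit Defensive.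

Import GRing.Theory Num.Theory.
Local Open Scope ring_scope.

(** A matrix keeps its determinant when its bivariate generating function
    B(X, Y) is replaced by u(x) v(y) B(X(x), Y(y)), where u(0) = v(0) = 1 and
    X(x), Y(y) are series starting with x and y: this multiplies the matrix on
    both sides by unitriangular matrices.  Let g = 1 + x g^3 be the generating
    function of the numbers a k, and put X = g(x) - 1, Y = g(y) - 1, so that
    x = X / (1 + X)^3.  The Hankel matrices of a k and of a (k + 1) have the
    generating functions (x g(x) - y g(y)) / (x - y) and
    (g(x) - g(y)) / (x - y).  In the variables X and Y these are
      (1 + X) (1 + Y) (1 - X Y) / D   and   (1 + X)^3 (1 + Y)^3 / D,
    with D = 1 - 3 X Y - X Y^2 - X^2 Y.  On the other hand, (1 - X Y) / D and
    (1 + X) / D are the generating functions of the two binomial matrices,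
    because Pascal's rule gives their rows the recurrence with characteristic
    polynomial D ([bin_row_rec]).

    The formal proof uses no power series.  By Lagrange inversion, the
    coefficient of x^i in g^(r+1) F(X) is the coefficient of X^i in
    F(X) (1 + X)^(3i+r) (1 - 2X), and this polynomial expression is taken as
    the definition of the change of variables ([weight], [transform]).  Then
    [transform_hankel] shows that the transformed matrix is constant along
    antidiagonals, and [transform_col0] computes its first column, so that it
    is a Hankel matrix with known entries; [det_hankel_rows] draws the
    conclusion for the determinants.  Finally [a_weight0] and [a_weight2]
    identify those entries with the numbers a k. *)

(** * Change of variables by Lagrange inversion *)

Lemma bin_double j : 'C(3 * j + 2, j.+1) = (2 * 'C(3 * j + 2, j))%N.
Proof.
apply/eqP; rewrite -(eqn_pmul2l (ltn0Sn j)) mul_bin_left; apply/eqP.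
by rewrite mulnA; congr (_ * _)%N; lia.
Qed.

Section Transfer.
Variable R : comNzRingType.
Implicit Types (f g h : {poly R}) (G B : {poly {poly R}}).

(** The Lagrange density of g^(r+1): in the notation of the opening comment,
    the coefficient of x^i in g^(r+1) F(g - 1) is that of X^i in
    F * weight r i.  The factor 1 - 2X is (1 + X) times the Jacobian factor
    1 - 3X / (1 + X). *)
Definition weight (r i : nat) : {poly R} :=
  (1 + 'X) ^+ (3 * i + r) * (1 - 2 * 'X).

Lemma coef_1DXn n k : ((1 + 'X : {poly R}) ^+ n)`_k = 'C(n, k)%:R.
Proof.
rewrite addrC exprD1n.
under eq_bigr => i _ do rewrite -scaler_nat.
rewrite -(poly_def n.+1 (fun i => 'C(n, i)%:R)) coef_poly ltnS.
by case: leqP => // ltnk; rewrite bin_small.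
Qed.

Lemma coef_weight0 r i : (weight r i)`_0 = 1.
Proof.
by rewrite coef0M coef_1DXn bin0 mul1r coefB coef1 coef0M coefX mulr0 subr0.
Qed.

Lemma coef_weightS r i k :
  (weight r i)`_k.+1 = 'C(3 * i + r, k.+1)%:R - 2 * 'C(3 * i + r, k)%:R.
Proof.
have -> : weight r i = (1 + 'X) ^+ (3 * i + r)
     - 2%:P * ((1 + 'X) ^+ (3 * i + r) * 'X).
  by rewrite polyCMn polyC1 /weight; ring.
by rewrite coefB coefCM coefMX /= !coef_1DXn.
Qed.

(** For i = j + 1 > 0 this is the coefficient of x^i in g^0 = 1, as
    weight 2 j = (1 + X)^(3 i - 1) (1 - 2X).  It is the reason why the
    Hankel property holds in [transform_hankel]. *)
Lemma coef_weight2 j : (weight 2 j)`_j.+1 = 0.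
Proof.
rewrite coef_weightS -natrM.
by rewrite bin_double subrr.
Qed.

Definition bicoef G i j : R := (G`_i)`_j.

Lemma bicoef_sep f h i j : bicoef (f ^:P * h%:P) i j = f`_i * h`_j.
Proof. by rewrite /bicoef coefMC coef_map /= coefCM. Qed.

Lemma bicoefB G G' i j : bicoef (G - G') i j = bicoef G i j - bicoef G' i j.
Proof. by rewrite /bicoef !coefB. Qed.

Local Notation x := ('X : {poly {poly R}}).
Local Notation y := (('X : {poly R})%:P : {poly {poly R}}).

Lemma bicoefX G i j : bicoef (x * G) i.+1 j = bicoef G i j.
Proof. by rewrite /bicoef coefXM. Qed.

Lemma bicoefY G i j : bicoef (y * G) i j.+1 = bicoef G i j.
Proof. by rewrite /bicoef coefCM coefXM. Qed.

Lemma weightX r i : (weight r i) ^:P = (1 + x) ^+ (3 * i + r) * (1 - 2 * x).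
Proof.
rewrite rmorphM rmorphXn rmorphD rmorphB rmorphM rmorph1 /= map_polyX.
by rewrite rmorph_nat.
Qed.

Lemma weightY r i : (weight r i)%:P = (1 + y) ^+ (3 * i + r) * (1 - 2 * y).
Proof.
by rewrite rmorphM rmorphXn rmorphD rmorphB rmorphM rmorph1 rmorph_nat.
Qed.

(** The common denominator D of the generating functions, with X the outer
    variable and Y the inner one. *)
Definition kernel : {poly {poly R}} :=
  1 - (3 * y + y ^+ 2) * x - y * x ^+ 2.

(** Up to the factor (1 + X)^3 (1 + Y)^3, the right-hand side is x - y written
    in terms of X and Y. *)
Lemma kernel_cubic : (x - y) * kernel = x * (1 + y) ^+ 3 - y * (1 + x) ^+ 3.
Proof. by rewrite /kernel; ring. Qed.

(** The coefficient of x^i y^j in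
    g(x)^(r+1) g(y)^(s+1) B(g(x) - 1, g(y) - 1). *)
Definition transform r s B i j : R :=
  bicoef (B * (weight r i) ^:P * (weight s j)%:P) i j.

(** Written with the weights of indices i and j, the two entries are the
    coefficients of X^(i+1) Y^(j+1) for Y (1 + X)^3 B and X (1 + Y)^3 B, so
    their difference comes, up to sign, from
    (X (1 + Y)^3 - Y (1 + X)^3) B = (X - Y) D B.
    By assumption, times the weights this is, up to terms of high degree in X,
    a difference of two products of a polynomial in one variable by a weight of
    exponent 2 in the other; each has a vanishing coefficient by
    [coef_weight2].  The remainder Q is there because B is a truncation of a
    power series in X. *)
Lemma transform_hankel r s B num f h Q N i j :
    kernel * B = num + x ^+ N * Q ->
    num * (x - y) * (1 + x) ^+ r * (1 + y) ^+ s =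
      f ^:P * (1 + y) ^+ 2 - (1 + x) ^+ 2 * h%:P ->
    (i.+1 < N)%N ->
  transform r s B i.+1 j = transform r s B i j.+1.
Proof.
move=> kB numE ltiN; apply/eqP; rewrite -subr_eq0; apply/eqP.
rewrite /transform -(bicoefY _ i.+1 j) -(bicoefX _ i j.+1) -bicoefB.
(* W' is the product of the weights at i and j, and W that for r = s = 0. *)
set W := (1 + x) ^+ (3 * i) * (1 - 2 * x) * (1 + y) ^+ (3 * j) * (1 - 2 * y).
pose W' := (1 + x) ^+ r * (1 + y) ^+ s * W.
have -> : y * (B * (weight r i.+1) ^:P * (weight s j)%:P)
    - x * (B * (weight r i) ^:P * (weight s j.+1)%:P)
  = (1 + x) ^+ 2 * h%:P * W - f ^:P * (1 + y) ^+ 2 * W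
    - x ^+ N * (Q * (x - y) * W').
  transitivity (- ((x - y) * (kernel * B) * W')).
    have -> : (x - y) * (kernel * B) = ((x - y) * kernel) * B by ring.
    rewrite kernel_cubic !weightX !weightY /W' /W !mulnS !exprD; ring.
  rewrite kB /W'.
  have -> : (x - y) * (num + x ^+ N * Q) * ((1 + x) ^+ r * (1 + y) ^+ s * W)
     = (num * (x - y) * (1 + x) ^+ r * (1 + y) ^+ s) * W
        + x ^+ N * (Q * (x - y) * ((1 + x) ^+ r * (1 + y) ^+ s * W)) by ring.
  by rewrite numE; ring.
rewrite !bicoefB [bicoef (x ^+ N * _) _ _]/bicoef coefXnM ltiN coef0 subr0.
have -> : (1 + x) ^+ 2 * h%:P * W = (weight 2 i) ^:P * (h * weight 0 j)%:P.
  by rewrite polyCM weightX weightY addn0 exprD /W; ring.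
have -> : f ^:P * (1 + y) ^+ 2 * W = (f * weight 0 i) ^:P * (weight 2 j)%:P.
  by rewrite rmorphM /= weightX weightY addn0 exprD /W; ring.
by rewrite !bicoef_sep !coef_weight2 mul0r mulr0 subr0.
Qed.

(** The numerator of the generating function of a sequence of rows that
    satisfies the recurrence with characteristic polynomial D. *)
Definition rec_num (P : nat -> {poly R}) : {poly {poly R}} :=
  (P 0%N)%:P + (P 1%N - (3 * 'X + 'X ^+ 2) * P 0%N)%:P * x.

(** Multiplying the truncated generating function by D telescopes, and only
    the two border terms of degree N + 2 and N + 3 in X survive. *)
Lemma kernel_rows (P : nat -> {poly R}) :
    (forall k, P k.+2 = (3 * 'X + 'X ^+ 2) * P k.+1 + 'X * P k) ->
  forall N, exists Q, kernel * \poly_(k < N.+2) P k = rec_num P + x ^+ N.+2 * Q.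
Proof.
move=> recP N; exists (- (P N.+2)%:P - y * (P N.+1)%:P * x).
have PE k : (P k.+2)%:P = (3 * y + y ^+ 2) * (P k.+1)%:P + y * (P k)%:P.
  by rewrite recP !rmorphD !rmorphM rmorphD rmorphM rmorphXn rmorph_nat.
rewrite poly_def; elim: N => [|N IH].
  rewrite !big_ord_recr big_ord0 /= -!mul_polyC PE /rec_num /kernel.
  rewrite rmorphB rmorphM rmorphD rmorphM rmorphXn rmorph_nat /=.
  rewrite expr0 expr1; ring.
rewrite big_ord_recr /= mulrDr IH -mul_polyC (PE N.+1) /kernel !exprS; ring.
Qed.

(** The transform as a product of three n x n matrices: the outer factors are
    triangular, so only rows and columns below n contribute. *)
Lemma transform_sum r s (P : nat -> {poly R}) N n i j :
    (i < n <= N)%N -> (j < n)%N ->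
  transform r s (\poly_(k < N) P k) i j =
  \sum_(k < n) \sum_(l < n)
    (if (k <= i)%N then (weight r i)`_(i - k) else 0) * (P k)`_l
    * (if (l <= j)%N then (weight s j)`_(j - l) else 0).
Proof.
move=> /andP[lt_in le_nN] lt_jn.
rewrite /transform /bicoef coefMC coefM mulr_suml coef_sum.
rewrite (big_ord_widen n (fun k => (((\poly_(k0 < N) P k0)`_k
   * ((weight r i) ^:P)`_(i - k) * weight s j)`_j))) //.
rewrite big_mkcond /=; apply: eq_bigr => k _.
rewrite ltnS; case: leqP => lek; last first.
  by rewrite big1 // => l _; rewrite !mul0r.
rewrite coef_poly (leq_trans (ltn_ord k) le_nN) coef_map /=.
rewrite mulrAC coefMC coefM mulr_suml.
rewrite (big_ord_widen n (fun l => (P k)`_l * (weight s j)`_(j - l)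
   * (weight r i)`_(i - k))) //.
rewrite big_mkcond /=; apply: eq_bigr => l _.
rewrite ltnS; case: leqP => lel; last by rewrite mulr0.
by rewrite mulrC mulrA.
Qed.

Definition weight_mx n r : 'M[R]_n :=
  \matrix_(i, k) if (k <= i)%N then (weight r i)`_(i - k) else 0.

Lemma det_weight_mx n r : \det (weight_mx n r) = 1.
Proof.
rewrite det_trig; last first.
  by apply/is_trig_mxP => i j ltij; rewrite mxE leqNgt ltij.
by rewrite big1 // => i _; rewrite mxE leqnn subnn coef_weight0.
Qed.

(** The column 0 of the transform depends only on the column 0 of the original
    matrix, whose generating function is the polynomial p0. *)
Lemma transform_col0 r s (P : nat -> {poly R}) (p0 : {poly R}) N n :
    (forall k, (P k)`_0 = p0`_k) -> (n < N)%N ->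
  transform r s (\poly_(k < N) P k) n 0 = (p0 * weight r n)`_n.
Proof.
move=> P0 lt_nN; rewrite /transform /bicoef coefMC coef0M coef_weight0 mulr1.
rewrite !coefM coef_sum; apply: eq_bigr => k _.
rewrite coef_poly (leq_trans (ltn_ord k) lt_nN) coef_map /= coefMC.
by rewrite P0.
Qed.

(** If the rows P k satisfy the recurrence attached to D and their numerator
    passes the test of [transform_hankel], the transform of their matrix is a
    Hankel matrix, read off from its first column, with the same
    determinants. *)
Lemma det_hankel_rows n r s (P : nat -> {poly R}) (p0 f h : {poly R}) :
    (forall k, P k.+2 = (3 * 'X + 'X ^+ 2) * P k.+1 + 'X * P k) ->
    (forall k, (P k)`_0 = p0`_k) ->
    rec_num P * (x - y) * (1 + x) ^+ r * (1 + y) ^+ s =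
      f ^:P * (1 + y) ^+ 2 - (1 + x) ^+ 2 * h%:P ->
  \det (\matrix_(i < n, j < n) (p0 * weight r (i + j))`_(i + j)) =
  \det (\matrix_(i < n, j < n) (P i)`_j).
Proof.
move=> recP P0 numE.
(* Hankel entries go up to index 2n - 2. *)
have [Q kB] := kernel_rows recP (n + n).
set N := (n + n).+2 in kB; set B := \poly_(k < N) P k in kB.
have hankel i j : (i + j < N)%N ->
    transform r s B i j = (p0 * weight r (i + j))`_(i + j).
  elim: j i => [|j IH] i ltN.
    by rewrite addn0 in ltN *; exact: transform_col0.
  rewrite -(transform_hankel _ kB numE) ?IH ?addSnnS //.
  by apply: leq_ltn_trans ltN; rewrite addnS ltnS leq_addr.
have -> : \matrix_(i < n, j < n) (p0 * weight r (i + j))`_(i + j) =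
    weight_mx n r *m (\matrix_(i < n, j < n) (P i)`_j) *m (weight_mx n s)^T.
  apply/matrixP => i j; have lti := ltn_ord i; have ltj := ltn_ord j.
  rewrite mxE -hankel; last by rewrite /N; lia.
  rewrite (@transform_sum _ _ _ _ n); [|by rewrite /N; lia|by []].
  rewrite !mxE exchange_big /=; apply: eq_bigr => l _.
  rewrite !mxE mulr_suml; apply: eq_bigr => k _.
  by rewrite !mxE.
by rewrite !det_mulmx det_tr !det_weight_mx mul1r mulr1.
Qed.

End Transfer.

(** * Rows of the binomial matrices *)

Section Rows.
Variables (R : comNzRingType) (e : nat).

(** The parameter e is 0 for the matrix of U and 1 for that of V. *)
Definition bin_entry k l : nat :=
  if (l <= 2 * k)%N then 'C(k + l + e, 2 * k - l) else 0.

Definition bin_row k : {poly R} := \poly_(l < (2 * k).+1) (bin_entry k l)%:R.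

Lemma coef_bin_row k l : (bin_row k)`_l = (bin_entry k l)%:R.
Proof. by rewrite coef_poly ltnS /bin_entry; case: leqP. Qed.

Lemma binS3 n q :
  'C(n.+3, q.+3) = (3 * 'C(n.+1, q.+2) + 'C(n, q.+3) + 'C(n, q))%N.
Proof. by rewrite !binS; lia. Qed.

(** Pascal's rule applied three times: comparing coefficients in
    (1 + z)^3 = 3 z (1 + z) + 1 + z^3.  The case analysis treats the columns
    where some of the lower indices leave the range of the rows; the bound on e
    makes column 0 vanish from row 2 on. *)
Lemma bin_row_rec (le_e1 : (e <= 1)%N) k :
  bin_row k.+2 = (3 * 'X + 'X ^+ 2) * bin_row k.+1 + 'X * bin_row k.
Proof.
apply/polyP => l.
have -> : (3 * 'X + 'X ^+ 2) * bin_row k.+1 + 'X * bin_row k =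
    'X * (3%:P * bin_row k.+1 + 'X * bin_row k.+1 + bin_row k).
  by rewrite polyCMn polyC1; ring.
rewrite coefXM; case: l => [|l] /=.
  by rewrite coef_bin_row /bin_entry bin_small //; lia.
rewrite !coefD coefCM coefXM !coef_bin_row /bin_entry.
case: l => [|l] /=.
  rewrite addr0 -natrM -natrD; congr (_%:R).
  have -> : (2 * k.+2 - 1 = (2 * k).+3)%N by lia.
  have -> : (k.+2 + 1 + e = (k + e).+3)%N by lia.
  have -> : (k.+1 + 0 + e = (k + e).+1)%N by lia.
  have -> : (2 * k.+1 - 0 = (2 * k).+2)%N by lia.
  have -> : (k + 0 + e = k + e)%N by lia.
  by rewrite binS3 [X in (_ + X + _)%N]bin_small ?subn0 ?addn0; lia.
rewrite -natrM -!natrD; congr (_%:R).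
have -> : (k.+2 + l.+2 + e = (k + l.+1 + e).+3)%N by lia.
have -> : (k.+1 + l.+1 + e = (k + l.+1 + e).+1)%N by lia.
have -> : (k.+1 + l + e = k + l.+1 + e)%N by lia.
have [q|] := leqP l.+1 (2 * k).
  have -> : (2 * k.+2 - l.+2 = (2 * k - l.+1).+3)%N by lia.
  have -> : (2 * k.+1 - l.+1 = (2 * k - l.+1).+2)%N by lia.
  have -> : (2 * k.+1 - l = (2 * k - l.+1).+3)%N by lia.
  by rewrite !ifT ?binS3; lia.
(* Columns 2k+2, 2k+3 and 2k+4 are treated apart, and beyond them every term
   is 0. *)
rewrite leq_eqVlt => /predU1P[l_eq|].
  have -> : l = (2 * k)%N by lia.
  have -> : (2 * k.+2 - (2 * k).+2 = 2)%N by lia.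
  have -> : (2 * k.+1 - (2 * k).+1 = 1)%N by lia.
  have -> : (2 * k.+1 - 2 * k = 2)%N by lia.
  by rewrite !ifT ?binS ?bin0; lia.
rewrite leq_eqVlt => /predU1P[l_eq|].
  have -> : l = (2 * k).+1 by lia.
  have -> : (2 * k.+2 - (2 * k).+3 = 1)%N by lia.
  have -> : (2 * k.+1 - (2 * k).+2 = 0)%N by lia.
  have -> : (2 * k.+1 - (2 * k).+1 = 1)%N by lia.
  by rewrite !ifT ?bin1 ?bin0; lia.
rewrite leq_eqVlt => /predU1P[l_eq|l_gt].
  have -> : l = (2 * k).+2 by lia.
  have -> : (2 * k.+2 - (2 * k).+4 = 0)%N by lia.
  have -> : (2 * k.+1 - (2 * k).+2 = 0)%N by lia.
  by rewrite ifT ?(ifN _ _ (_ : ~~ ((2 * k).+3 <= _)%N)) ?ifT ?bin0; lia.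
by rewrite !ifN //; lia.
Qed.

End Rows.

Lemma binzE e i j :
  binz (i%:Z + j%:Z + e%:Z) (2 * i%:Z - j%:Z) = bin_entry e i j.
Proof.
rewrite /bin_entry -!PoszD; case: leqP => [le_j2i|lt_2ij].
  by rewrite -PoszM subzn.
have -> : 2 * i%:Z - j%:Z = Negz (j - (2 * i).+1) by lia.
by [].
Qed.

Lemma bin_row0 (R : comNzRingType) e : bin_row R e 0 = 1.
Proof.
apply/polyP => l; rewrite coef_bin_row coef1 /bin_entry.
by case: l => [|l] //=; rewrite bin0.
Qed.

Lemma bin_row1 (R : comNzRingType) e :
  bin_row R e 1 = 'C(e.+1, 2)%:R%:P + e.+2%:R *: 'X + 'X ^+ 2.
Proof.
apply/polyP => l; rewrite coef_bin_row !coefD coefC coefZ coefX coefXn.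
case: l => [|[|[|l]]] //=; rewrite /bin_entry /= ?bin1 ?bin0 ?mulr0 ?mulr1.
- by rewrite !addr0.
- by rewrite addr0 add0r.
- by rewrite !add0r.
- by rewrite !addr0.
Qed.

Lemma bin_row_coef0 (R : comNzRingType) e k : (e <= 1)%N ->
  (bin_row R e k)`_0 = (1 + e%:R *: 'X : {poly R})`_k.
Proof.
move=> le_e1; rewrite coef_bin_row coefD coef1 coefZ coefX /bin_entry /=.
case: k => [|[|k]]; rewrite /= ?mulr0 ?mulr1 ?addr0 ?add0r.
- by rewrite bin0.
- by case: e le_e1 => [|[|]].
- by rewrite bin_small //; lia.
Qed.

Lemma rec_num_bin_row0 (R : comNzRingType) :
  rec_num (bin_row R 0) = 1 - ('X : {poly R})%:P * 'X.
Proof.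
rewrite /rec_num bin_row0 bin_row1 bin_small // -mul_polyC.
have -> : 0%:R%:P + 2%:R%:P * 'X + 'X ^+ 2 - (3 * 'X + 'X ^+ 2) * 1
    = - 'X :> {poly R}.
  by rewrite !polyCMn polyC1; ring.
by rewrite polyCN polyC1 mulNr.
Qed.

Lemma rec_num_bin_row1 (R : comNzRingType) : rec_num (bin_row R 1) = 1 + 'X.
Proof.
rewrite /rec_num bin_row0 bin_row1 binn -mul_polyC.
have -> : 1%:R%:P + 3%:R%:P * 'X + 'X ^+ 2 - (3 * 'X + 'X ^+ 2) * 1
    = 1 :> {poly R}.
  by rewrite polyCMn polyC1; ring.
by rewrite polyC1 mul1r.
Qed.

(** * Entries of the two Hankel matrices *)

Lemma a_weight0 n : (weight rat 0 n)`_n = a n.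
Proof.
rewrite /a; case: n => [|n]; first by rewrite coef_weight0 bin0 mulr1 divr1.
have n3 : (2 * n.+1 + 1)%:R != 0 :> rat by rewrite pnatr_eq0; lia.
apply: (mulfI n3); rewrite mul1r mulVKf // coef_weightS addn0.
have /(congr1 (fun m => m%:R : rat)) := mul_bin_left (3 * n.+1) n.
have -> : (3 * n.+1 - n = 2 * n.+1 + 1)%N by lia.
rewrite !natrM => E.
rewrite mulrBr [_ * (2 * _)]mulrCA -E natrD natrM; ring.
Qed.

Lemma a_weight2 n : (weight rat 2 n)`_n = a n.+1.
Proof.
have n3 : (2 * n.+1 + 1)%:R != 0 :> rat by rewrite pnatr_eq0; lia.
apply: (mulfI n3); rewrite /a mul1r mulVKf //.
have -> : (3 * n.+1 = (3 * n + 2).+1)%N by lia.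
case: n n3 => [|n] n3; first by rewrite coef_weight0.
have /(congr1 (fun m => m%:R : rat)) := mul_bin_left (3 * n.+1 + 2) n.
have -> : (3 * n.+1 + 2 - n = 2 * n.+2 + 1)%N by lia.
rewrite !natrM coef_weightS binS bin_double natrD natrM => E2.
rewrite mulrBr [_ * (2 * _)]mulrCA -E2 natrD natrM; ring.
Qed.

Theorem mainTheorem1 (n : nat) :
  U n = \det (\matrix_(i < n, j < n)
          (binz (i%:Z + j%:Z) (2 * i%:Z - j%:Z))%:R) /\
  V n = \det (\matrix_(i < n, j < n)
          (binz (i%:Z + j%:Z + 1) (2 * i%:Z - j%:Z))%:R).
Proof.
split.
- transitivity (\det (\matrix_(i < n, j < n) (bin_row rat 0 i)`_j)); last first.
    congr (\det _); apply/matrixP => i j; rewrite !mxE coef_bin_row.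
    by rewrite -[(_ + _)%R as X in binz X]addr0 binzE.
  (* (X - Y) (1 - X Y) = X (1 + Y)^2 - (1 + X)^2 Y *)
  rewrite -(@det_hankel_rows rat n 0 0 _ (1 + 0%:R *: 'X) 'X 'X).
  + congr (\det _); apply/matrixP => i j.
    by rewrite !mxE scale0r addr0 mul1r a_weight0.
  + exact: bin_row_rec.
  + by move=> k; exact: bin_row_coef0.
  + rewrite rec_num_bin_row0 map_polyX; ring.
- transitivity (\det (\matrix_(i < n, j < n) (bin_row rat 1 i)`_j)); last first.
    by congr (\det _); apply/matrixP => i j; rewrite !mxE coef_bin_row binzE.
  (* The exponents differ because only X occurs in the numerator 1 + X:
     g^2 on the rows and g^3 on the columns make the product
     (X - Y) (1 + X)^2 (1 + Y)^2 symmetric up to sign. *)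
  rewrite -(@det_hankel_rows rat n 1 2 _ (1 + 1%:R *: 'X)
              ('X * (1 + 'X) ^+ 2) ('X * (1 + 'X) ^+ 2)).
  + congr (\det _); apply/matrixP => i j.
    rewrite !mxE addn1 -a_weight2.
    have -> // : (1 + 1%:R *: 'X) * weight rat 1 (i + j) = weight rat 2 (i + j).
    by rewrite scale1r /weight addn1 addn2 !exprS; ring.
  + exact: bin_row_rec.
  + by move=> k; exact: bin_row_coef0.
  + rewrite rec_num_bin_row1 polyCM polyC_exp polyCD polyC1.
    rewrite rmorphM rmorphXn rmorphD rmorph1 /= map_polyX; ring.
Qed.
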